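(* Let $d\ge 1$ and let $\Phi(N,n)$ be complex weights ($N\ge 1$ integer, $n\in\mathbb Z$) such that for every $N$ the function $n\mapsto\Phi(N,n)$ has bounded support and $\sum_{n=-\infty}^{+\infty}\Phi(N,n)=1$. There exists a function $f$ in the Sobolev space $W^{\frac d2,2}(\mathbb T^d)$ such that for every irrational vector $\alpha\in\mathbb R^d$ and every positive integer $N$, $$\sup_{x\in\mathbb T^d}\left|\mathcal D_N^{\Phi,\alpha}f(x)\right|=+\infty.$$ Moreover, for this $f$, if the sequence $\{\Phi(N,n)\}_{n=-\infty}^{+\infty}$ is non-negative, then $\sup_{x\in\mathbb T^d}\left|\mathcal D_N^{\Phi,\alpha}f(x)\right|=+\infty$ for every $\alpha\in\mathbb R^d$.
   Context: $\mathbb T^d=\mathbb R^d/\mathbb Z^d$; functions on $\mathbb T^d$ are identified with $\mathbb Z^d$-periodic functions on $\mathbb R^d$. A vector $\alpha=(\alpha_1,\dots,\alpha_d)\in\mathbb R^d$ is irrational if $1,\alpha_1,\dots,\alpha_d$ are linearly independent over $\mathbb Q$. Fourier coefficients: $\widehat f(m)=\int_{\mathbb T^d}f(x)e^{-2\pi i m\cdot x}dx$, $m\in\mathbb Z^d$. For $\delta>0$, $W^{\delta,2}(\mathbb T^d)$ is the space of distributions on $\mathbb T^d$ with $\|f\|_{\delta,2}=\left(\sum_{m\in\mathbb Z^d}(1+|m|^2)^\delta|\widehat f(m)|^2\right)^{1/2}<\infty$. Since elements of this space are defined up to null sets, the supremum is understood as an essential supremum. The weighted discrepancy is $$\mathcal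 D_N^{\Phi,\alpha}f(x)=\sum_{n=-\infty}^{+\infty}\Phi(N,n)f(x+n\alpha)-\int_{\mathbb T^d}f(y)\,dy .$$ *)

(* Defs.v *)
From HB Require Import structures.
From mathcomp Require Import all_boot all_order all_algebra.
From mathcomp Require Import complex.
From mathcomp Require Import all_classical all_reals all_analysis.
From mathcomp Require Import ess_sup_inf.

Set Implicit Arguments.
Unset Strict Implicit.
Unset Printing Implicit Defensive.

Import Order.TTheory GRing.Theory Num.Theory.
Import numFieldNormedType.Exports.

Local Open Scope classical_set_scope.
Local Open Scope ring_scope.
Local Open Scope complex_scope.

(* [measurableTypeR R] is [R] with its Borel sigma-algebra, so that
   [Euclidean R d] carries the product (i.e. Borel) sigma-algebra. *)
Notation Euclidean R d := (d.-tuple (measurableTypeR R)).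

Section Torus.
Context {R : realType}.

Definition tuple_cons d (p : measurableTypeR R * Euclidean R d) :
  Euclidean R d.+1 := [the d.+1.-tuple (measurableTypeR R) of p.1 :: p.2].

Lemma measurable_tuple_cons d : measurable_fun [set: _] (@tuple_cons d).
Proof. by apply: measurable_cons. Qed.

HB.instance Definition _ d :=
  isMeasurableFun.Build _ _ _ _ (@tuple_cons d) (@measurable_tuple_cons d).

(* The normalized Lebesgue measure of the torus, carried by the
   cube [0,1]^d: the product of d copies of the Lebesgue measure of [0,1]. *)
Fixpoint torus_measure (d : nat) : probability (Euclidean R d) R :=
  match d with
  | 0 => dirac (nil_tuple (measurableTypeR R))
  | d'.+1 => distribution (uniform_prob (@ltr01 R) \x torus_measure d')%E
               (@tuple_cons d')
  end.

(* Functions on the torus are Z^d-periodic functions on R^d. *)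
Definition Zperiodic d (f : Euclidean R d -> R[i]) : Prop :=
  forall (x : Euclidean R d) (k : d.-tuple int),
    f [tuple tnth x i + (tnth k i)%:~R | i < d] = f x.

Definition translate d (x : Euclidean R d) (n : int) (alpha : Euclidean R d) :
  Euclidean R d := [tuple tnth x i + tnth alpha i *~ n | i < d].

Definition torus_integrable d (f : Euclidean R d -> R[i]) : Prop :=
  (torus_measure d).-integrable setT (fun x => (complex.Re (f x))%:E) /\
  (torus_measure d).-integrable setT (fun x => (complex.Im (f x))%:E).

Definition torus_integral d (f : Euclidean R d -> R[i]) : R[i] :=
  (\int[torus_measure d]_x complex.Re (f x)) +i*
  (\int[torus_measure d]_x complex.Im (f x)).

Definition expi (t : R) : R[i] := cos t +i* sin t.

Definition dot d (m : d.-tuple int) (x : Euclidean R d) : R :=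
  \sum_(i < d) (tnth m i)%:~R * tnth x i.

Definition fourier_coef d (f : Euclidean R d -> R[i]) (m : d.-tuple int) :
  R[i] := torus_integral (fun x => f x * expi (- (2 * pi * dot m x))).

Definition sqnorm d (m : d.-tuple int) : R :=
  \sum_(i < d) (tnth m i)%:~R ^+ 2.

Definition sobolev_norm d (delta : R) (f : Euclidean R d -> R[i]) : \bar R :=
  ((\esum_(m in [set: d.-tuple int])
     ((1 + sqnorm m) `^ delta * Normc.normc (fourier_coef f m) ^+ 2)%R%:E)
   `^ 2^-1)%E.

(* Membership of a function in W^{delta,2}(T^d), to be used for delta >= 0: the
   distributions in that space are then given by integrable (even L^2)
   functions, defined up to null sets, with no loss in choosing the
   representative to be Borel and everywhere periodic. *)
Definition sobolev d (delta : R) (f : Euclidean R d -> R[i]) : Prop :=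
  [/\ measurable_fun setT (fun x => complex.Re (f x)),
      measurable_fun setT (fun x => complex.Im (f x)),
      Zperiodic f, torus_integrable f & (sobolev_norm delta f < +oo)%E].

(* 1, alpha_1, ..., alpha_d are linearly independent over Q. *)
Definition irrational_vector d (alpha : Euclidean R d) : Prop :=
  forall (q0 : rat) (q : 'I_d -> rat),
    ratr q0 + \sum_(i < d) ratr (q i) * tnth alpha i = 0 :> R ->
    q0 = 0 /\ forall i, q i = 0.

(* The sum over [set: int] is a sum over the support of the summand, which is
   finite as soon as [Phi N] has bounded support. *)
Definition weights (Phi : nat -> int -> R[i]) : Prop :=
  forall N, (0 < N)%N ->
    (exists B : nat, forall n : int, (B < `|n|)%N -> Phi N n = 0) /\
    \sum_(n \in [set: int]) Phi N n = 1.

Definition discrepancy d (Phi : nat -> int -> R[i]) (alpha : Euclidean R d)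
    (f : Euclidean R d -> R[i]) (N : nat) (x : Euclidean R d) : R[i] :=
  \sum_(n \in [set: int]) Phi N n * f (translate x n alpha)
  - torus_integral f.

Definition sup_discrepancy d (Phi : nat -> int -> R[i])
    (alpha : Euclidean R d) (f : Euclidean R d -> R[i]) (N : nat) : \bar R :=
  ess_sup (torus_measure d)
    (fun x => (Normc.normc (discrepancy Phi alpha f N x))%:E).

End Torus.

(* Main.v *)
(* With [n = 2 ^ k], let [fejer k] be the Fejer kernel divided by [n]: it takes
   values in [0, 1] and equals [1] at the integers, it is at most
   [4 ^- k / sin(pi t)^2], and its Fourier coefficients are at most [2 ^- k] and
   vanish for [|m| >= 2 ^ k].  The function
     f(x) = sum_k (k + 1)^-1 prod_i fejer k x_i
   is nonnegative, is bounded outside every neighbourhood of [Z^d], and tends to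
   infinity at the points of [Z^d] since the harmonic series diverges.
   A frequency with [|m|_oo ~ 2 ^ L] has coefficient [O(L^-1 2^(-d L))] and there
   are [O(2^(d L))] of them, so that the square of the [W^(d/2,2)] norm is
   [O(sum_L L^-2)].  If [Phi(N, n0) <> 0], the term [n0] of the discrepancy blows up at
   [- n0 alpha]; the others stay bounded there when [alpha] is irrational, and
   cannot compensate when the weights are nonnegative. *)
Require Import Defs.
From mathcomp Require Import all_boot all_order all_algebra.
From mathcomp Require Import complex ring lra zify.
From mathcomp Require Import all_classical all_reals all_analysis.
From mathcomp Require Import measurable_realfun ess_sup_inf.

Set Implicit Arguments.
Unset Strict Implicit.
Unset Printing Implicit Defensive.

Import Order.TTheory GRing.Theory Num.Theory.
Import numFieldNormedType.Exports.

Local Open Scope classical_set_scope.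
Local Open Scope ring_scope.
Local Open Scope complex_scope.

(** * Fejer kernels on the circle and their Fourier coefficients *)

Section fejer_kernel.
Context {R : realType}.
Implicit Types (t u : R) (k : nat) (m : int).

Lemma cosD2piz t m : cos (t + 2 * pi * m%:~R) = cos t.
Proof.
have cosD2pin n (s : R) : cos (s + 2 * pi * n%:R) = cos s.
  rewrite (_ : 2 * pi * n%:R = (pi *+ 2) *+ n); last by rewrite -mulr_natr; ring.
  exact: (periodicn (@cosD2pi R)).
case: m => n; first exact: cosD2pin.
rewrite NegzE -[LHS](cosD2pin n.+1) mulrNz -pmulrn; congr cos; ring.
Qed.

(* The Fejer kernel of order [2 ^ k] divided by its maximum [2 ^ k], written as
   a Riesz product. *)
Definition fejer k t : R :=
  \prod_(i < k) ((1 + cos (2 ^+ i * (2 * pi * t))) / 2).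

Lemma fejer0 t : fejer 0 t = 1. Proof. by rewrite /fejer big_ord0. Qed.

Lemma fejerS k t :
  fejer k.+1 t = fejer k t * ((1 + cos (2 ^+ k * (2 * pi * t))) / 2).
Proof. by rewrite /fejer big_ord_recr. Qed.

Lemma fejer_ge0 k t : 0 <= fejer k t.
Proof.
apply: prodr_ge0 => i _.
by rewrite divr_ge0// -lerBlDl sub0r cos_geN1.
Qed.

Lemma le_fejer k l t : (k <= l)%N -> fejer l t <= fejer k t.
Proof.
move=> /subnK <-; elim: (l - k)%N => // n IH.
rewrite addSn fejerS; apply: le_trans IH.
rewrite ler_piMr ?fejer_ge0// ler_pdivrMr// mul1r.
by have := cos_le1 (2 ^+ (n + k) * (2 * pi * t)); lra.
Qed.

Lemma fejer_le1 k t : fejer k t <= 1.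
Proof. by rewrite -(fejer0 t) le_fejer. Qed.

Lemma fejer_at0 k : fejer k 0 = 1.
Proof.
elim: k => [|k IH]; first by rewrite fejer0.
by rewrite fejerS IH !mulr0 cos0 mul1r divff.
Qed.

Lemma fejerDz k t m : fejer k (t + m%:~R) = fejer k t.
Proof.
rewrite /fejer; apply: eq_bigr => i _; congr ((1 + _) / 2).
rewrite -[RHS](cosD2piz _ ((2 ^ i)%N%:Z * m)); congr cos.
by rewrite intrM -pmulrn natrX; ring.
Qed.

Lemma continuous_fejer k : continuous (fejer k).
Proof.
elim: k => [|k IH] t.
  rewrite (_ : fejer 0 = cst 1); first exact: cvg_cst.
  by apply/funext => s; rewrite fejer0.
rewrite (_ : fejer k.+1 =
  (fun s => fejer k s * ((1 + cos (2 ^+ k * (2 * pi * s))) / 2))); last first.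
  by apply/funext => s; rewrite fejerS.
apply: cvgM; first exact: IH.
apply: cvgM; last exact: cvg_cst.
apply: cvgD; first exact: cvg_cst.
apply: (@continuous_comp _ _ _ (fun s => 2 ^+ k * (2 * pi * s)) cos);
  last exact: continuous_cos.
apply: cvgM; first exact: cvg_cst.
by apply: cvgM; [exact: cvg_cst|exact: cvg_id].
Qed.

Lemma measurable_fejer k : measurable_fun [set: measurableTypeR R] (fejer k).
Proof. by apply: continuous_measurable_fun; exact: continuous_fejer. Qed.

(** Each Riesz factor is [cos (2 ^+ k * (pi * t)) ^+ 2], so the double-angle formula for the sine
    closes the induction. Without division the identity also makes sense at integers. *)
Lemma fejer_sin k t :
  4 ^+ k * sin (pi * t) ^+ 2 * fejer k t = sin (2 ^+ k * (pi * t)) ^+ 2.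
Proof.
elim: k => [|k IH]; first by rewrite fejer0 !expr0; rewrite !mul1r mulr1.
rewrite fejerS (exprS 4).
transitivity (4 * (4 ^+ k * sin (pi * t) ^+ 2 * fejer k t) *
   ((1 + cos (2 ^+ k * (2 * pi * t))) / 2)); first ring.
rewrite IH (exprS 2 k).
rewrite (_ : 2 ^+ k * (2 * pi * t) = (2 ^+ k * (pi * t)) *+ 2); last first.
  by rewrite -mulr_natr; ring.
rewrite (_ : 2 * 2 ^+ k * (pi * t) = (2 ^+ k * (pi * t)) *+ 2); last first.
  by rewrite -mulr_natr; ring.
by rewrite sin_mulr2n cos_mulr2n; field.
Qed.

Lemma fejer_decay k t : sin (pi * t) != 0 ->
  fejer k t <= (sin (pi * t) ^+ 2)^-1 * 4^-1 ^+ k.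
Proof.
move=> s0; have s20 : 0 < sin (pi * t) ^+ 2 by rewrite exprn_even_gt0.
rewrite exprVn -invfM -[leRHS]mul1r ler_pdivlMr; last first.
  exact: mulr_gt0 s20 (exprn_gt0 _ _).
rewrite mulrC [_ * 4 ^+ k]mulrC fejer_sin sin2cos2.
  by have := sqr_ge0 (cos (2 ^+ k * (pi * t))); lra.
Qed.

(** Triangular coefficients of the Fejer kernel; the truncated subtraction on naturals cuts them off
    at [2 ^ k]. *)
Definition fejer_coef k m : R := (2 ^ k - `|m|)%N%:R / 4 ^+ k.

(** A tent of half-width [2 ^ k.+1] is a combination of three tents of half-width [2 ^ k], centred
    at 0 and at plus or minus [2 ^ k]. This mirrors multiplication by a new Riesz factor. *)
Lemma fejer_coefS k m : fejer_coef k.+1 m = fejer_coef k m / 2 +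
  (fejer_coef k (m + (2 ^ k)%N%:Z) + fejer_coef k (m - (2 ^ k)%N%:Z)) / 4.
Proof.
have E : (2 ^ k.+1 - `|m| = 2 * (2 ^ k - `|m|) +
  (2 ^ k - `|(m + (2 ^ k)%N%:Z)%R|) + (2 ^ k - `|(m - (2 ^ k)%N%:Z)%R|))%N.
  by rewrite expnS; lia.
rewrite /fejer_coef E 2!natrD natrM exprS; field.
by rewrite expf_neq0.
Qed.

Lemma fejer_coef_ge0 k m : 0 <= fejer_coef k m.
Proof. by rewrite divr_ge0// exprn_ge0. Qed.

Lemma fejer_coef_le k m : fejer_coef k m <= 2^-1 ^+ k.
Proof.
rewrite ler_pdivrMr ?exprn_gt0// exprVn.
rewrite (_ : 4 = 2 * 2 :> R); last by rewrite -natrM.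
rewrite exprMn mulKf ?expf_neq0// -natrX ler_nat; exact: leq_subr.
Qed.

Lemma fejer_coef_eq0 k m : (2 ^ k <= `|m|)%N -> fejer_coef k m = 0.
Proof. by rewrite /fejer_coef -subn_eq0 => /eqP ->; rewrite mul0r. Qed.

Lemma Rintegral_prob_cst d (T : measurableType d) (P : probability T R) (r : R) :
  \int[P]_x r = r.
Proof.
rewrite Rintegral_cst// -[RHS]mulr1; congr (r * _).
by have /= -> := probability_setT P.
Qed.

Lemma bounded_Rintegrable d (T : measurableType d) (P : probability T R)
    (h : T -> R) (M : R) :
  measurable_fun setT h -> (forall x, `|h x| <= M) ->
  P.-integrable setT (EFin \o h).
Proof.
move=> mh hM; apply: measurable_bounded_integrable => //.
  exact: le_lt_trans (probability_le1 P measurableT) (ltry _).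
exists M; split; first exact: num_real.
by move=> N MN x _ /=; exact: le_trans (hM x) (ltW MN).
Qed.

Local Notation U := (uniform_prob (@ltr01 R)).

Lemma measurable_cos_affine (a b : R) :
  measurable_fun [set: measurableTypeR R] (fun t => cos (a * t + b)).
Proof.
apply: continuous_measurable_fun => t.
apply: (@continuous_comp _ _ _ (fun s => a * s + b) cos);
  last exact: continuous_cos.
apply: cvgD; last exact: cvg_cst.
by apply: cvgM; [exact: cvg_cst|exact: cvg_id].
Qed.

(** The free phase [u] treats cosines and sines together, so that complex coefficients reduce to
    real integrals. *)
Lemma integral_uniform01_cos m u :
  \int[U]_t cos (2 * pi * m%:~R * t + u) = (m == 0)%:R * cos u.
Proof.
have [->|m0] := eqVneq m 0.
  under eq_Rintegral do rewrite mulr0 mul0r add0r.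
  by rewrite Rintegral_prob_cst mul1r.
pose c : R := 2 * pi * m%:~R; rewrite -/c mul0r.
have c0 : c != 0.
  rewrite mulf_neq0 ?intr_eq0// mulf_neq0 ?pnatr_eq0//.
  by rewrite gt_eqF// pi_gt0.
(* A primitive of 1 plus the cosine: the added 1 makes the integrand nonnegative, as
   [integral_uniform] requires, and is subtracted afterwards. *)
pose F (t : R) := t + c^-1 * sin (c * t + u).
have dF (t : R) : is_derive t 1 F (1 + cos (c * t + u)).
  have dl : is_derive t 1 (fun s : R => c * s + u) c.
    by apply: is_derive_eq; rewrite /GRing.scale /=; ring.
  have ds := @is_derive1_comp _ sin (fun s : R => c * s + u) t _ _
    (is_derive_sin _) dl.
  apply: is_derive_eq.
  by rewrite /GRing.scale /=; field.
have cvF (t : R) : {for t, continuous F}.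
  by apply/differentiable_continuous/derivable1_diffP; case: (dF t).
have FTC : (\int[lebesgue_measure]_(t in `[0%R, 1%R]) (1 + cos (c * t + u))%:E
    = (F 1)%:E - (F 0)%:E)%E.
  apply: continuous_FTC2 => //.
  - apply: continuous_subspaceT => t.
    apply: cvgD; first exact: cvg_cst.
    apply: (@continuous_comp _ _ _ (fun s => c * s + u) cos);
      last exact: continuous_cos.
    apply: cvgD; last exact: cvg_cst.
    by apply: cvgM; [exact: cvg_cst|exact: cvg_id].
  - split; first by move=> t _; case: (dF t).
    + exact/cvg_at_right_filter/cvF.
    + exact/cvg_at_left_filter/cvF.
  - by move=> t _; rewrite derive1E; case: (dF t).
have mc := measurable_cos_affine c u.
have -> : \int[U]_t cos (c * t + u) =
    \int[U]_t (1 + cos (c * t + u)) - \int[U]_t 1.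
  rewrite -RintegralB//.
  - by apply: eq_Rintegral => t _; rewrite addrAC subrr add0r.
  - apply: (@bounded_Rintegrable _ _ _ _ 2); first exact: measurable_funD.
    move=> t; rewrite (le_trans (ler_normD _ _))// normr1.
    by rewrite (_ : 2 = 1 + 1)// lerD// cos_max.
  - by apply: (@bounded_Rintegrable _ _ _ _ 1) => // t; rewrite normr1.
rewrite Rintegral_prob_cst.
have mf : measurable_fun setT
    (fun t : measurableTypeR R => (1 + cos (c * t + u))%:E).
  by apply/measurable_EFinP; exact: measurable_funD.
have f0 (t : measurableTypeR R) : (0 <= (1 + cos (c * t + u))%:E)%E.
  by rewrite lee_fin -lerBlDl sub0r cos_geN1.
rewrite {1}/Rintegral (integral_uniform (@ltr01 R) mf f0).
rewrite subr0 invr1 mul1e FTC /= /F mulr0 mulr1 add0r.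
rewrite add0r (_ : sin (c + u) = sin u); first by ring.
rewrite -!cosBpihalf -[RHS](cosD2piz _ m); congr cos; rewrite /c; ring.
Qed.

Lemma integral_uniform01_fejer k m u :
  \int[U]_t (fejer k t * cos (2 * pi * m%:~R * t + u)) =
  fejer_coef k m * cos u.
Proof.
elim: k m u => [|k IH] m u.
  under eq_Rintegral do rewrite fejer0 mul1r.
  rewrite integral_uniform01_cos (_ : fejer_coef 0 m = (m == 0)%:R)//.
  rewrite /fejer_coef expr0 expn0 divr1.
  by case: m => [[|n]|n]; rewrite ?subn0//= subSS sub0n.
have intZ r v : U.-integrable setT (EFin \o
    (fun t => r * (fejer k t * cos (2 * pi * v%:~R * t + u)))).
  apply: (@bounded_Rintegrable _ _ _ _ `|r|).
    apply: measurable_funM => //; apply: measurable_funM.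
      exact: measurable_fejer.
    exact: measurable_cos_affine.
  move=> t; rewrite normrM ler_piMr// normrM mulr_ile1 ?cos_max//.
  by rewrite ger0_norm ?fejer_ge0 ?fejer_le1.
have int1 v : U.-integrable setT (EFin \o
    (fun t => fejer k t * cos (2 * pi * v%:~R * t + u))).
  by apply: eq_integrable (intZ 1 v) => // t _; rewrite /= mul1r.
pose P : int := (2 ^ k)%N%:Z.
(* Product-to-sum: the new Riesz factor spreads the frequency [m] over [m], [m + P] and [m - P],
   with weights 1/2, 1/4 and 1/4. *)
transitivity (\int[U]_t (2^-1 * (fejer k t * cos (2 * pi * m%:~R * t + u)) +
    (4^-1 * (fejer k t * cos (2 * pi * (m + P)%:~R * t + u)) +
     4^-1 * (fejer k t * cos (2 * pi * (m - P)%:~R * t + u))))).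
  apply: eq_Rintegral => t _; rewrite fejerS.
  rewrite (_ : 2 * pi * (m + P)%:~R * t + u = (2 * pi * m%:~R * t + u) +
    2 ^+ k * (2 * pi * t)); last first.
    by rewrite intrD /P -pmulrn natrX; ring.
  rewrite (_ : 2 * pi * (m - P)%:~R * t + u = (2 * pi * m%:~R * t + u) -
    2 ^+ k * (2 * pi * t)); last first.
    by rewrite intrB /P -pmulrn natrX; ring.
  by move: (2 * pi * m%:~R * t + u) => v; rewrite cosB cosD; field.
rewrite RintegralD//; last first.
  have := integrableD measurableT (intZ 4^-1 (m + P)) (intZ 4^-1 (m - P)).
  by apply: eq_integrable.
rewrite RintegralD// !RintegralZl// !IH fejer_coefS -/P; first by field.
Qed.

End fejer_kernel.

(** * Product kernels on the torus *)

Section torus_integral.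
Context {R : realType}.
Local Notation U := (uniform_prob (@ltr01 R)).

Lemma tuple_cons0 d (p : measurableTypeR R * Euclidean R d) :
  tnth (tuple_cons p) ord0 = p.1.
Proof. by rewrite (tnth_nth 0). Qed.

Lemma tuple_consS d (p : measurableTypeR R * Euclidean R d) i :
  tnth (tuple_cons p) (lift ord0 i) = tnth p.2 i.
Proof. by rewrite !(tnth_nth 0). Qed.

(** Fubini along the recursive definition of [torus_measure]; the uniform bound supplies every
    integrability condition. *)
Lemma Rintegral_torusS d (h : Euclidean R d.+1 -> R) (M : R) :
  measurable_fun setT h -> (forall x, `|h x| <= M) ->
  \int[torus_measure d.+1]_x h x =
  \int[torus_measure d]_y \int[U]_t h (tuple_cons (t, y)).
Proof.
move=> mh hM.
have mc : measurable_fun setT (h \o @tuple_cons R d).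
  exact: measurableT_comp.
have ic : (U \x torus_measure d)%E.-integrable setT
    (EFin \o (h \o @tuple_cons R d)).
  apply: (@bounded_Rintegrable R _ _ (U \x torus_measure d)%E _ M) => //.
  by move=> x; exact: hM.
rewrite /Rintegral integral_distribution//; last exact/measurable_EFinP.
rewrite -integral21_prod_meas1//.
congr fine; apply: eq_integral => y _ /=.
rewrite fineK//; apply: integrable_fin_num => //.
apply: (@bounded_Rintegrable R _ _ U _ M) => //.
apply: (measurableT_comp mc); exact: measurable_pair2.
Qed.

Definition tfejer d k (x : Euclidean R d) : R :=
  \prod_(i < d) fejer k (tnth x i).

Definition tfejer_coef d k (m : d.-tuple int) : R :=
  \prod_(i < d) fejer_coef k (tnth m i).

Lemma tfejer_ge0 d k (x : Euclidean R d) : 0 <= tfejer k x.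
Proof. by apply: prodr_ge0 => i _; exact: fejer_ge0. Qed.

Lemma tfejer_le1 d k (x : Euclidean R d) : tfejer k x <= 1.
Proof. by apply: prodr_ile1 => i _; rewrite fejer_ge0 fejer_le1. Qed.

Lemma measurable_tfejer d k : measurable_fun setT (@tfejer d k).
Proof.
apply: measurable_prod => i _.
by apply: measurableT_comp; [exact: measurable_fejer|exact: measurable_tnth].
Qed.

Lemma measurable_dot d (m : d.-tuple int) : measurable_fun setT (@dot R d m).
Proof.
apply: measurable_sum => i; apply: measurable_funM => //.
exact: measurable_tnth.
Qed.

Lemma measurable_cos_dot d (m : d.-tuple int) (u : R) :
  measurable_fun setT (fun x => cos (2 * pi * dot m x + u)).
Proof.
apply: (measurableT_comp (f := cos)).
  by apply: continuous_measurable_fun; exact: continuous_cos.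
apply: measurable_funD => //; apply: measurable_funM => //.
exact: measurable_dot.
Qed.

Lemma norm_tfejer_cos d k (x : Euclidean R d) (v : R) :
  `|tfejer k x * cos v| <= 1.
Proof.
rewrite normrM mulr_ile1 ?cos_max//.
by rewrite ger0_norm ?tfejer_ge0 ?tfejer_le1.
Qed.

(** Induction on the dimension, integrating the first coordinate: the other coordinates enter
    through the phase, hence the arbitrary [u]. *)
Lemma integral_tfejer_cos d k (m : d.-tuple int) (u : R) :
  \int[torus_measure d]_x (tfejer k x * cos (2 * pi * dot m x + u)) =
  tfejer_coef k m * cos u.
Proof.
elim: d => [|d IH] in m u *.
  rewrite -[RHS](Rintegral_prob_cst (torus_measure 0)).
  apply: eq_Rintegral => x _.
  by rewrite /tfejer /tfejer_coef /dot !big_ord0 mulr0 add0r.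
rewrite (@Rintegral_torusS _ _ 1); last 2 first.
- apply: measurable_funM; first exact: measurable_tfejer.
  exact: measurable_cos_dot.
- by move=> x; exact: norm_tfejer_cos.
pose m' := [tuple of behead m]; pose m0 := thead m.
have m'E i : tnth m (lift ord0 i) = tnth m' i.
  by rewrite !(tnth_nth 0) /= nth_behead.
have inner y : \int[U]_t (tfejer k (tuple_cons (t, y)) *
      cos (2 * pi * dot m (tuple_cons (t, y)) + u)) =
    fejer_coef k m0 * (tfejer k y * cos (2 * pi * dot m' y + u)).
  transitivity (\int[U]_t (tfejer k y *
      (fejer k t * cos (2 * pi * m0%:~R * t + (2 * pi * dot m' y + u))))).
    apply: eq_Rintegral => t _; rewrite /tfejer big_ord_recl tuple_cons0 /=.
    under eq_bigr do rewrite tuple_consS/=.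
    rewrite [RHS]mulrA [fejer k t * _]mulrC; congr (_ * _); congr cos.
    rewrite /dot big_ord_recl tuple_cons0 /= -/m0.
    by under eq_bigr do rewrite tuple_consS m'E/=; ring.
  rewrite RintegralZl//.
    by rewrite integral_uniform01_fejer mulrCA.
  apply: (@bounded_Rintegrable _ _ _ _ _ 1).
    apply: measurable_funM; first exact: measurable_fejer.
    exact: measurable_cos_affine.
  move=> t; rewrite normrM mulr_ile1 ?cos_max//.
  by rewrite ger0_norm ?fejer_ge0 ?fejer_le1.
under eq_Rintegral do rewrite inner.
rewrite RintegralZl//.
  rewrite IH mulrA; congr (_ * _).
  rewrite /tfejer_coef big_ord_recl; congr (_ * _).
  by apply: eq_bigr => i _; rewrite m'E.
apply: (@bounded_Rintegrable _ _ _ _ _ 1).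
  apply: measurable_funM; first exact: measurable_tfejer.
  exact: measurable_cos_dot.
by move=> x; exact: norm_tfejer_cos.
Qed.

End torus_integral.

(** * The singular series: size, blow-up and coefficient bounds *)

Section singular_series.
Context {R : realType}.

Lemma sum_half_tail L n :
  \sum_(L <= k < n) 2^-1 ^+ k <= 2 * 2^-1 ^+ L :> R.
Proof.
have [nL|/ltnW] := leqP n L.
  by rewrite big_geq// mulr_ge0// exprn_ge0.
(* Subtracting the remaining tail gives a bound that the induction preserves. *)
move=> Ln; apply: (@le_trans _ _ (2 * 2^-1 ^+ L - 2 * 2^-1 ^+ n)); last first.
  by rewrite lerBlDr lerDl mulr_ge0// exprn_ge0.
rewrite -(subnK Ln); elim: (n - L)%N => [|j IH].
  by rewrite add0n big_geq// subrr.
rewrite addSn big_nat_recr/=; last exact: leq_addl.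
rewrite exprS; lra.
Qed.

Lemma nneseries_ub (v : nat -> R) (M : R) :
  (forall k, 0 <= v k) -> (forall n, \sum_(0 <= k < n) v k <= M) ->
  (\sum_(k <oo) (v k)%:E <= M%:E)%E.
Proof.
move=> v0 vM; apply: lime_le.
  by apply: is_cvg_nneseries => k _ _; rewrite lee_fin.
by near=> n; rewrite sumEFin lee_fin.
Unshelve. all: by end_near. Qed.

Lemma tfejer_coef_ge0 d k (m : d.-tuple int) : 0 <= tfejer_coef k m :> R.
Proof. by apply: prodr_ge0 => i _; exact: fejer_coef_ge0. Qed.

Lemma tfejer_coef_le d k (m : d.-tuple int) :
  tfejer_coef k m <= (2^-1 ^+ d) ^+ k :> R.
Proof.
rewrite exprAC (_ : _ ^+ d = \prod_(i < d) (2^-1 ^+ k)); last first.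
  by rewrite prodr_const card_ord.
by apply: ler_prod => i _; rewrite fejer_coef_ge0 fejer_coef_le.
Qed.

Lemma tfejer_coef_eq0 d k (m : d.-tuple int) (i : 'I_d) :
  (2 ^ k <= `|tnth m i|)%N -> tfejer_coef k m = 0 :> R.
Proof.
by move=> ki; rewrite /tfejer_coef (bigD1 i)//= fejer_coef_eq0// mul0r.
Qed.

Local Notation a := (@harmonic R).

(* The function itself is [singular], where the poles of [esingular] (the
   lattice points) get the junk value [0] of [fine]. *)
Definition esingular d (x : Euclidean R d) : \bar R :=
  (\sum_(k <oo) (a k * tfejer k x)%:E)%E.

Definition singular d (x : Euclidean R d) : R := fine (esingular x).

Lemma harmonic_le1 k : a k <= 1.
Proof. by rewrite /harmonic invf_le1// ler1n. Qed.

Lemma singular_term_ge0 d k (x : Euclidean R d) : 0 <= a k * tfejer k x.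
Proof. by rewrite mulr_ge0 ?harmonic_ge0 ?tfejer_ge0. Qed.

Lemma esingular_ge0 d (x : Euclidean R d) : (0 <= esingular x)%E.
Proof. by apply: nneseries_ge0 => k _ _; rewrite lee_fin singular_term_ge0. Qed.

Lemma singular_ge0 d (x : Euclidean R d) : 0 <= singular x.
Proof. exact/fine_ge0/esingular_ge0. Qed.

Lemma singular_le d (x : Euclidean R d) : ((singular x)%:E <= esingular x)%E.
Proof.
rewrite /singular; have := esingular_ge0 x.
by case: (esingular x) => [r||] // _; rewrite leey.
Qed.

Lemma measurable_esingular d : measurable_fun setT (@esingular d).
Proof.
apply: ge0_emeasurable_sum => k.
  by move=> x _ _; rewrite lee_fin singular_term_ge0.
move=> _; apply/measurable_EFinP; apply: measurable_funM => //.
exact: measurable_tfejer.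
Qed.

Lemma measurable_singular d : measurable_fun setT (@singular d).
Proof.
by apply: measurableT_comp => //; exact: measurable_esingular.
Qed.

Lemma Zperiodic_singular d (x : Euclidean R d) (z : d.-tuple int) :
  singular [tuple tnth x i + (tnth z i)%:~R | i < d] = singular x.
Proof.
congr fine; apply: eq_eseriesr => k _; congr (_ * _)%:E.
by apply: eq_bigr => i _; rewrite tnth_mktuple fejerDz.
Qed.

(* Away from the lattice hyperplanes [x_i] in [Z] the series converges, like
   [sum_k 4^-k]. *)
Lemma esingular_decay d (x : Euclidean R d) i : sin (pi * tnth x i) != 0 ->
  (esingular x <= (2 / sin (pi * tnth x i) ^+ 2)%:E)%E.
Proof.
move=> s0; have s20 : 0 < sin (pi * tnth x i) ^+ 2 by rewrite exprn_even_gt0.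
apply: nneseries_ub => [k|n]; first exact: singular_term_ge0.
apply: (@le_trans _ _ (\sum_(0 <= k < n)
    ((sin (pi * tnth x i) ^+ 2)^-1 * 2^-1 ^+ k))).
  apply: ler_sum => k _; rewrite -[leRHS]mul1r ler_pM ?harmonic_le1 ?harmonic_ge0//.
    exact: tfejer_ge0.
  apply: (@le_trans _ _ (fejer k (tnth x i))).
    rewrite /tfejer (bigD1 i)//= ler_piMr ?fejer_ge0//.
    by apply: prodr_ile1 => j _; rewrite fejer_ge0 fejer_le1.
  apply: (le_trans (fejer_decay k s0)).
  by rewrite ler_wpM2l ?invr_ge0 ?(ltW s20)// lerXn2r ?nnegrE//; lra.
rewrite -mulr_sumr mulrC ler_wpM2r ?invr_ge0 ?(ltW s20)//.
by apply: (le_trans (sum_half_tail 0 n)); rewrite expr0 mulr1.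
Qed.

Lemma singular_decay d (x : Euclidean R d) i : sin (pi * tnth x i) != 0 ->
  singular x <= 2 / sin (pi * tnth x i) ^+ 2.
Proof.
by move=> /esingular_decay; rewrite -lee_fin; exact: le_trans (singular_le x).
Qed.

(** Squaring removes the sign: by the half-angle formula the square depends on [cos (2 * pi * t)]
    only. *)
Lemma sqr_sinpiDz (t : R) (z : int) :
  sin (pi * (t + z%:~R)) ^+ 2 = sin (pi * t) ^+ 2.
Proof.
have E (s : R) : sin (pi * s) ^+ 2 = (1 - cos (2 * pi * s)) / 2.
  rewrite (_ : 2 * pi * s = (pi * s) *+ 2); last ring.
  by rewrite cos_mulr2n sin2cos2; field.
by rewrite !E mulrDr cosD2piz.
Qed.

Lemma sinpi_neq0 (t : R) (z : int) :
  0 < t - z%:~R < 1 -> sin (pi * t) != 0.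
Proof.
move=> /andP[t0 t1]; rewrite -sqrf_eq0 -(subrK z%:~R t) sqr_sinpiDz sqrf_eq0.
rewrite gt_eqF// sin_gt0_pi// mulr_gt0 ?pi_gt0//=.
by rewrite -[ltRHS]mulr1 ltr_pM2l ?pi_gt0.
Qed.

Lemma harmonic_unbounded (M : R) : exists K, M <= \sum_(0 <= k < K) a k.
Proof.
apply: contrapT => noK; apply: (@dvg_harmonic R).
apply: nondecreasing_is_cvgn.
  by apply: nondecreasing_series => k _ _; exact: harmonic_ge0.
exists M => _ [K _ <-]; rewrite leNgt; apply/negP => MK.
by apply: noK; exists K; exact: ltW.
Qed.

(** Near a lattice point the first [K] product kernels are all at least [2^-1 ^+ d.+1], and harmonic
    partial sums are unbounded. The strict inequalities keep the coordinates off the integers, so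
    that the series is finite and [singular] is its true value. *)
Lemma singular_unbounded d (M : R) : exists2 eps : R, 0 < eps <= 1 &
  forall (x : Euclidean R d.+1) (z : d.+1.-tuple int),
    (forall i, 0 < tnth x i - (tnth z i)%:~R < eps) -> M <= singular x.
Proof.
(* The factor [2 ^+ d.+1] pays for a loss of 1/2 in each coordinate; the absolute value allows
   negative [M]. *)
have [K MK] := harmonic_unbounded (`|M| * 2 ^+ d.+1).
have : \forall t \near (0 : R), 2^-1 < fejer K t.
  have := @continuous_fejer R K 0; rewrite /continuous_at fejer_at0 => /cvgr_gt.
  by apply; lra.
move=> /nbhs_ballP[e /= e0 he]; exists (Num.min e 1).
  by rewrite lt_min e0 ltr01 ge_min lexx orbT.
move=> x z xz.
have xz1 i : 0 < tnth x i - (tnth z i)%:~R < 1.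
  by have := xz i; rewrite lt_min => /and3P[-> _ ->].
have fin_x : esingular x \is a fin_num.
  rewrite ge0_fin_numE ?esingular_ge0//.
  exact: le_lt_trans (esingular_decay (sinpi_neq0 (xz1 ord0))) (ltry _).
rewrite -lee_fin /singular fineK//.
apply: (@le_trans _ _ (\sum_(0 <= k < K) (a k * tfejer k x)%:E)%E); last first.
  by apply: nneseries_lim_ge => k _ _; rewrite lee_fin singular_term_ge0.
rewrite sumEFin lee_fin.
have xK : 2^-1 ^+ d.+1 <= tfejer K x.
  rewrite (_ : _ ^+ d.+1 = \prod_(i < d.+1) 2^-1); last first.
    by rewrite prodr_const card_ord.
  apply: ler_prod => i _; rewrite invr_ge0 ler0n/=.
  rewrite -(subrK (tnth z i)%:~R (tnth x i)) fejerDz ltW//; apply: he.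
  have /andP[x0] := xz i; rewrite lt_min => /andP[xe _].
  by rewrite /ball/= sub0r normrN gtr0_norm.
apply: (@le_trans _ _ (\sum_(0 <= k < K) (a k * 2^-1 ^+ d.+1))).
  rewrite -mulr_suml exprVn ler_pdivlMr ?exprn_gt0//.
  by apply: le_trans MK; rewrite ler_wpM2r ?exprn_ge0// ler_norm.
rewrite !big_mkord; apply: ler_sum => k _; rewrite ler_pM2l ?harmonic_gt0//.
apply: (le_trans xK); apply: ler_prod => i _; rewrite fejer_ge0/=.
exact: le_fejer (ltnW (ltn_ord k)).
Qed.

(* Bounds the Fourier coefficient at [m] of [singular]. *)
Definition coef_bound d (m : d.-tuple int) : \bar R :=
  (\sum_(k <oo) (a k * tfejer_coef k m)%:E)%E.

Lemma coef_bound_le2 d (m : d.+1.-tuple int) : (coef_bound m <= 2%:E)%E.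
Proof.
apply: nneseries_ub => [k|n]; first by rewrite mulr_ge0 ?harmonic_ge0 ?tfejer_coef_ge0.
apply: (@le_trans _ _ (\sum_(0 <= k < n) 2^-1 ^+ k)).
  apply: ler_sum => k _; rewrite -[leRHS]mul1r ler_pM ?harmonic_le1 ?harmonic_ge0//.
    exact: tfejer_coef_ge0.
  apply: (le_trans (tfejer_coef_le k m)).
  rewrite lerXn2r ?nnegrE ?exprn_ge0// exprS ler_piMr//.
  by rewrite exprn_ile1// ; lra.
by apply: (le_trans (sum_half_tail 0 n)); rewrite expr0 mulr1.
Qed.

(** Only the terms with [L <= k] survive. There [a k <= a L], and [tfejer_coef_le] leaves a
    geometric series of ratio at most 1/2, whose sum is at most twice its first term. *)
Lemma coef_bound_level d (m : d.+1.-tuple int) L :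
  (forall k, (k < L)%N -> tfejer_coef k m = 0 :> R) ->
  (coef_bound m <= (2 * a L * (2^-1 ^+ d.+1) ^+ L)%:E)%E.
Proof.
move=> mL.
apply: nneseries_ub => [k|n]; first by rewrite mulr_ge0 ?harmonic_ge0 ?tfejer_coef_ge0.
have [nL|/ltnW Ln] := leqP n L.
  rewrite big1_seq => [|k]; last first.
    rewrite mem_index_iota => /andP[_ /andP[_ kn]].
    by rewrite mL ?mulr0//; exact: leq_trans nL.
  by rewrite !mulr_ge0 ?harmonic_ge0 ?exprn_ge0 ?invr_ge0.
rewrite (@big_cat_nat _ _ _ L)//= big1_seq ?add0r => [|k]; last first.
  by rewrite mem_index_iota => /andP[_ /andP[_ kL]]; rewrite mL ?mulr0.
(* The factor [2 ^+ L] will cancel the [2^-1 ^+ L] that [sum_half_tail] brings. *)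
apply: (@le_trans _ _ (\sum_(L <= k < n)
    (a L * (2^-1 ^+ d.+1) ^+ L * 2 ^+ L) * 2^-1 ^+ k)).
  rewrite big_nat_cond [leRHS]big_nat_cond; apply: ler_sum => k.
  rewrite andbT => /andP[Lk _].
  rewrite -2!mulrA ler_pM ?tfejer_coef_ge0 ?harmonic_ge0//.
    by rewrite lef_pV2 ?posrE// ler_nat.
  apply: (le_trans (tfejer_coef_le k m)).
  rewrite -(subnK Lk) addnC !exprD ler_pM2l ?exprn_gt0 ?invr_gt0//.
  rewrite mulrA -exprMn divff// expr1n mul1r.
  rewrite lerXn2r ?nnegrE ?exprn_ge0// exprS ler_piMr//.
  by rewrite exprn_ile1//; lra.
rewrite -mulr_sumr.
apply: (le_trans (ler_wpM2l _ (sum_half_tail L n))).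
  by rewrite !mulr_ge0 ?harmonic_ge0 ?exprn_ge0 ?invr_ge0.
rewrite (_ : _ * (2 * _) = 2 * a L * (2^-1 ^+ d.+1) ^+ L * (2 * 2^-1) ^+ L).
  by rewrite divff// expr1n mulr1.
by rewrite exprMn; ring.
Qed.

End singular_series.

(** * Fourier coefficients of the singular function *)

Section fourier.
Context {R : realType} (d : nat).
Local Notation a := (@harmonic R).
Local Notation T := (torus_measure d.+1 : probability (Euclidean R d.+1) R).
Implicit Types (m : d.+1.-tuple int) (u : R).

Let m0 : d.+1.-tuple int := [tuple 0 | i < d.+1].

Lemma integral_tfejer k : \int[T]_x tfejer k x = tfejer_coef k m0.
Proof.
have := @integral_tfejer_cos R d.+1 k m0 0; rewrite cos0 mulr1 => <-.
apply: eq_Rintegral => x _; rewrite /dot big1 ?mulr0 ?addr0 ?cos0 ?mulr1// => i _.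
by rewrite tnth_mktuple mul0r.
Qed.

Lemma bounded_integral_fine (h : Euclidean R d.+1 -> R) (M : R) :
  measurable_fun setT h -> (forall x, `|h x| <= M) ->
  (\int[T]_x (h x)%:E = (\int[T]_x h x)%:E)%E.
Proof.
move=> mh hM; rewrite /Rintegral fineK//.
exact: integrable_fin_num (bounded_Rintegrable T mh hM).
Qed.

Lemma norm_tfejer (k : nat) (x : Euclidean R d.+1) : `|tfejer k x| <= 1.
Proof. by rewrite ger0_norm ?tfejer_ge0 ?tfejer_le1. Qed.

Lemma integral_esingular : (\int[T]_x esingular x = coef_bound m0)%E.
Proof.
rewrite integral_nneseries//; last 2 first.
- move=> k; apply/measurable_EFinP; apply: measurable_funM => //.
  exact: measurable_tfejer.
- by move=> k x _; rewrite lee_fin singular_term_ge0.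
apply: eq_eseriesr => k _.
rewrite (@bounded_integral_fine _ (a k)); last 2 first.
- by apply: measurable_funM => //; exact: measurable_tfejer.
- move=> x; rewrite normrM ger0_norm ?harmonic_ge0//.
  by rewrite ler_piMr ?harmonic_ge0 ?norm_tfejer.
rewrite RintegralZl ?integral_tfejer//.
apply: (bounded_Rintegrable _ (@measurable_tfejer R d.+1 k)) => x.
exact: norm_tfejer.
Qed.

Lemma integrable_esingular : T.-integrable setT (@esingular R d.+1).
Proof.
apply/integrableP; split; first exact: measurable_esingular.
under eq_integral do rewrite gee0_abs ?esingular_ge0//.
by rewrite integral_esingular (le_lt_trans (coef_bound_le2 _)) ?ltry.
Qed.

(** An integrable function is finite almost everywhere, so the junk value is taken on a null set
    only. *)
Lemma ae_singular : ae_eq T setT (fun x => (singular x)%:E) (@esingular R d.+1).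
Proof.
have := integrable_ae measurableT integrable_esingular.
by apply: filterS => x /= xfin _; rewrite /singular fineK// xfin.
Qed.

Lemma integral_singular : (\int[T]_x (singular x)%:E = coef_bound m0)%E.
Proof.
rewrite -integral_esingular; apply: ae_eq_integral => //.
- by apply/measurable_EFinP; exact: measurable_singular.
- exact: measurable_esingular.
- exact: ae_singular.
Qed.

Lemma integrable_singular : T.-integrable setT (EFin \o @singular R d.+1).
Proof.
apply/integrableP; split.
  by apply/measurable_EFinP; exact: measurable_singular.
under eq_integral do rewrite gee0_abs ?lee_fin ?singular_ge0//.
by rewrite integral_singular (le_lt_trans (coef_bound_le2 _)) ?ltry.
Qed.

Lemma integrable_singular_cos m u :
  T.-integrable setT (EFin \o (fun x => singular x * cos (2 * pi * dot m x + u))).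
Proof.
apply: (le_integrable measurableT _ _ integrable_singular).
  apply/measurable_EFinP; apply: measurable_funM; first exact: measurable_singular.
  exact: measurable_cos_dot.
move=> x _ /=; rewrite lee_fin normrM ler_piMr//; exact: cos_max.
Qed.

(** Adding 1 to the cosine makes every term nonnegative, so that monotone convergence allows
    integration term by term. *)
Lemma integral_singular_cosD1 m u :
  (\int[T]_x (singular x * (1 + cos (2 * pi * dot m x + u)))%:E <=
   coef_bound m0 + coef_bound m)%E.
Proof.
have w0 x : 0 <= 1 + cos (2 * pi * dot m x + u).
  by rewrite -lerBlDl sub0r cos_geN1.
have mw : measurable_fun setT (fun x => 1 + cos (2 * pi * dot m x + u)).
  by apply: measurable_funD => //; exact: measurable_cos_dot.
pose v k x := a k * (tfejer k x * (1 + cos (2 * pi * dot m x + u))).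
have mv k : measurable_fun setT (fun x => (v k x)%:E).
  apply/measurable_EFinP; do 2 apply: measurable_funM => //.
  exact: measurable_tfejer.
have v0 k x : (0 <= (v k x)%:E)%E.
  by rewrite lee_fin !mulr_ge0 ?harmonic_ge0 ?tfejer_ge0.
apply: (@le_trans _ _ (\int[T]_x \sum_(k <oo) (v k x)%:E)%E).
  apply: ge0_le_integral => //.
  - by move=> x _; rewrite lee_fin mulr_ge0 ?singular_ge0.
  - apply/measurable_EFinP; apply: measurable_funM => //.
    exact: measurable_singular.
  - by apply: ge0_emeasurable_sum => // k x _ _.
  - move=> x _; rewrite mulrC EFinM.
    apply: (le_trans (lee_wpmul2l _ (singular_le x))); first by rewrite lee_fin.
    rewrite /esingular -nneseriesZl => [|k _]; last first.
      by rewrite lee_fin singular_term_ge0.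
    apply: lee_nneseries.
      by move=> k _ _; rewrite -EFinM lee_fin mulr_ge0 ?singular_term_ge0.
    by move=> k _; rewrite -EFinM lee_fin /v mulrCA [_ * tfejer k x]mulrC.
rewrite integral_nneseries// /coef_bound -nneseriesD; last 2 first.
- by move=> k _ _; rewrite lee_fin mulr_ge0 ?harmonic_ge0 ?tfejer_coef_ge0.
- by move=> k _ _; rewrite lee_fin mulr_ge0 ?harmonic_ge0 ?tfejer_coef_ge0.
apply: lee_nneseries; first by move=> k _ _; exact: integral_ge0.
move=> k _.
have int1 := bounded_Rintegrable T (@measurable_tfejer R d.+1 k) (norm_tfejer k).
have mtc : measurable_fun setT (fun x => tfejer k x * cos (2 * pi * dot m x + u)).
  apply: measurable_funM; first exact: measurable_tfejer.
  exact: measurable_cos_dot.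
have int2 := bounded_Rintegrable T mtc (fun x => norm_tfejer_cos k x _).
have intD := integrableD measurableT int1 int2.
have intv : T.-integrable setT
    (EFin \o (fun x => tfejer k x * (1 + cos (2 * pi * dot m x + u)))).
  by apply: eq_integrable intD => // x _; rewrite /= -EFinD; congr EFin; ring.
have -> : (\int[T]_x (v k x)%:E = (\int[T]_x v k x)%:E)%E.
  rewrite /Rintegral fineK//; apply: integrable_fin_num => //.
  have := integrableZl measurableT (a k) intv.
  by apply: eq_integrable.
rewrite lee_fin RintegralZl//.
under eq_Rintegral do rewrite mulrDr mulr1.
rewrite RintegralD// integral_tfejer integral_tfejer_cos mulrDr lerD2l.
rewrite ler_wpM2l ?harmonic_ge0// ler_piMr ?tfejer_coef_ge0 ?cos_le1//.
Qed.

Lemma coef_bound_fin m : @coef_bound R d.+1 m \is a fin_num.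
Proof.
rewrite ge0_fin_numE; first exact: le_lt_trans (coef_bound_le2 m) (ltry _).
apply: nneseries_ge0 => k _ _.
by rewrite lee_fin mulr_ge0 ?harmonic_ge0 ?tfejer_coef_ge0.
Qed.

(** The integral of [singular] is exactly the zero-frequency [coef_bound], a finite quantity that
    cancels in [integral_singular_cosD1]. *)
Lemma integral_singular_cos_le m u :
  \int[T]_x (singular x * cos (2 * pi * dot m x + u)) <= fine (@coef_bound R _ m).
Proof.
have iS := integrable_singular; have iSc := integrable_singular_cos m u.
have iD : T.-integrable setT
    (EFin \o (fun x => singular x * (1 + cos (2 * pi * dot m x + u)))).
  have := integrableD measurableT iS iSc.
  by apply: eq_integrable => // x _; rewrite /= -EFinD; congr EFin; ring.
rewrite -(lerD2l (\int[T]_x singular x)) -RintegralD//.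
have := integral_singular_cosD1 m u.
rewrite -(fineK (integrable_fin_num measurableT iD)).
rewrite -(fineK (coef_bound_fin m0)) -(fineK (coef_bound_fin m)) -EFinD lee_fin.
rewrite {2}/Rintegral integral_singular; apply: le_trans.
rewrite le_eqVlt; apply/orP; left; apply/eqP; apply: eq_Rintegral => x _; ring.
Qed.

(** Shifting the phase by [pi] flips the sign of the cosine and turns the upper bound into a lower
    one. *)
Lemma norm_integral_singular_cos m u :
  `|\int[T]_x (singular x * cos (2 * pi * dot m x + u))| <= fine (@coef_bound R _ m).
Proof.
rewrite ler_norml integral_singular_cos_le andbT lerNl.
apply: le_trans (integral_singular_cos_le m (u + pi)).
rewrite -mulN1r -RintegralZl//; last exact: integrable_singular_cos.
by under eq_Rintegral do rewrite mulrCA mulN1r -cosDpi -addrA.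
Qed.

End fourier.

(** * Membership in the Sobolev space of order half the dimension *)

Section sobolev_bound.
Context {R : realType} (d : nat).
Local Notation a := (@harmonic R).
Local Notation f := (fun x : Euclidean R d.+1 => (singular x)%:C).
Local Notation q := (2^-1 ^+ d.+1 : R).
Implicit Types m : d.+1.-tuple int.

Lemma normc_le_ReIm (z : R[i]) :
  Normc.normc z <= `|complex.Re z| + `|complex.Im z|.
Proof.
case: z => x y /=; rewrite -[leRHS]ger0_norm ?addr_ge0// -sqrtr_sqr.
rewrite ler_wsqrtr// sqrrD !real_normK ?num_real//.
by rewrite lerD2r lerDl mulrn_wge0// mulr_ge0.
Qed.

Lemma Re_le_normc (z : R[i]) : complex.Re z <= Normc.normc z.
Proof.
case: z => x y /=; apply: (le_trans (ler_norm x)).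
by rewrite -sqrtr_sqr ler_wsqrtr// lerDl sqr_ge0.
Qed.

(** The real and imaginary parts are the cosine integrals with phases 0 and [pi / 2]; each costs one
    [coef_bound]. *)
Lemma fourier_coef_singular m :
  Normc.normc (fourier_coef f m) <= 2 * fine (@coef_bound R _ m).
Proof.
apply: (le_trans (normc_le_ReIm _)); rewrite mulr_natl mulr2n /fourier_coef /=.
apply: lerD.
  rewrite (@eq_Rintegral _ _ _ _ _
    (fun x => singular x * cos (2 * pi * dot m x + 0))).
    by move=> *; exact: norm_integral_singular_cos.
  by move=> x _; rewrite mul0r subr0 cosN addr0.
rewrite (@eq_Rintegral _ _ _ _ _
    (fun x => singular x * cos (2 * pi * dot m x + pi / 2))).
  by move=> *; exact: norm_integral_singular_cos.
by move=> x _; rewrite mul0r addr0 cosDpihalf sinN.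
Qed.

(** The 16 is the square of the 4 in the bound [4 * a L * q ^+ L] on a coefficient; the power comes
    from [sobolev_weight_le]. *)
Definition sobolev_cst : R := 16 * d.+2%:R `^ (d.+1%:R / 2).

Lemma sobolev_cst_ge0 : 0 <= sobolev_cst.
Proof. by rewrite mulr_ge0 ?powR_ge0. Qed.

(** Take the least dyadic scale [L] containing [m]: for [k < L] some coordinate reaches [2 ^ k],
    which kills the product coefficient. *)
Lemma dyadic_level m : exists L, (forall i, (`|tnth m i| < 2 ^ L)%N) /\
  forall k, (k < L)%N -> tfejer_coef k m = 0 :> R.
Proof.
pose P L := [forall i, (`|tnth m i| < 2 ^ L)%N].
have [|L /forallP LP Lmin] := @ex_minnP P _.
  exists (\sum_(i < d.+1) `|tnth m i|)%N; apply/forallP => i.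
  apply: leq_ltn_trans (ltn_expl _ _) => //.
  by rewrite (bigD1 i)//= leq_addr.
exists L; split => // k kL.
have : ~~ P k by apply: contraL kL => /Lmin; rewrite -leqNgt.
rewrite negb_forall; move/existsP; case=> i.
by rewrite -leqNgt; exact: tfejer_coef_eq0.
Qed.

(** Each of the [d.+1] coordinates, and the 1, contributes at most [4 ^ L] to the base, which gives
    the factor [d.+2]; the exponent then takes [4 ^ L] to [2 ^ (d.+1 * L)]. *)
Lemma sobolev_weight_le m L : (forall i, (`|tnth m i| < 2 ^ L)%N) ->
  (1 + sqnorm m) `^ (d.+1%:R / 2) <=
  d.+2%:R `^ (d.+1%:R / 2) * (2 ^+ d.+1) ^+ L :> R.
Proof.
move=> mL.
have sq : 1 + sqnorm m <= d.+2%:R * (2 ^+ L) ^+ 2 :> R.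
  rewrite [d.+2%:R]mulrS mulrDl mul1r lerD//.
    by rewrite exprn_ege1// exprn_ege1// ler1n.
  rewrite /sqnorm mulr_natl -[X in _ *+ X](card_ord d.+1) -sumr_const.
  apply: ler_sum => i _; rewrite -[leLHS]real_normK ?num_real//.
  rewrite lerXn2r ?nnegrE ?exprn_ge0// -intr_norm -abszE -pmulrn -natrX ler_nat.
  exact: ltnW.
have s0 : 0 <= sqnorm m :> R by apply: sumr_ge0 => i _; exact: sqr_ge0.
apply: (@le_trans _ _ ((d.+2%:R * (2 ^+ L) ^+ 2) `^ (d.+1%:R / 2))).
  apply: ge0_ler_powR;
    by rewrite ?nnegrE ?divr_ge0 ?addr_ge0// ?mulr_ge0 ?exprn_ge0.
rewrite powRM ?exprn_ge0// ler_wpM2l ?powR_ge0//.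
rewrite -powR_mulrn ?exprn_ge0// -powRrM mulrCA divff// mulr1.
by rewrite powR_mulrn ?exprn_ge0// exprAC.
Qed.

(** The squared coefficient carries [q ^+ L] twice: the weight cancels one, and the other is kept to
    absorb the number of frequencies at level [L]. *)
Lemma sobolev_term_le m : exists2 L, (forall i, (`|tnth m i| < 2 ^ L)%N) &
  (1 + sqnorm m) `^ (d.+1%:R / 2) * Normc.normc (fourier_coef f m) ^+ 2 <=
  sobolev_cst * (a L ^+ 2 * q ^+ L).
Proof.
have [L [mL m0]] := dyadic_level m; exists L => //.
have q0 : 0 <= q ^+ L by rewrite !exprn_ge0.
have fL : Normc.normc (fourier_coef f m) <= 4 * a L * q ^+ L.
  apply: (le_trans (fourier_coef_singular m)).
  rewrite (_ : 4 * _ * _ = 2 * (2 * a L * q ^+ L)); last ring.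
  by rewrite ler_wpM2l// -lee_fin fineK ?coef_bound_fin// coef_bound_level.
apply: (@le_trans _ _ (d.+2%:R `^ (d.+1%:R / 2) * (2 ^+ d.+1) ^+ L *
    (4 * a L * q ^+ L) ^+ 2)).
  rewrite ler_pM ?powR_ge0 ?exprn_ge0 ?sobolev_weight_le//.
    by case: (fourier_coef _ _) => x y /=; exact: sqrtr_ge0.
  rewrite lerXn2r ?nnegrE ?(mulr_ge0 _ q0) ?mulr_ge0 ?harmonic_ge0//.
  by case: (fourier_coef _ _) => x y /=; exact: sqrtr_ge0.
have qq : (2 ^+ d.+1) ^+ L * q ^+ L = 1.
  by rewrite -!exprMn divff// !expr1n.
rewrite le_eqVlt; apply/orP; left; apply/eqP; rewrite /sobolev_cst.
transitivity (d.+2%:R `^ (d.+1%:R / 2) * ((2 ^+ d.+1) ^+ L * q ^+ L) *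
  (16 * a L ^+ 2 * q ^+ L)); first ring.
by rewrite qq; ring.
Qed.

(** Adding [N] to each coordinate embeds the cube into the tuples over ['I_(N + N)]. *)
Lemma card_cube N (s : seq (d.+1.-tuple int)) : uniq s ->
  (size [seq m <- s | [forall i, (`|tnth m i| < N)%N]] <= (N + N) ^ d.+1)%N.
Proof.
move=> us.
pose D : seq (d.+1.-tuple int) :=
  [seq [tuple (nat_of_ord (tnth t i))%:Z - N%:Z | i < d.+1]
    | t : d.+1.-tuple 'I_(N + N)].
have sD : size D = ((N + N) ^ d.+1)%N.
  by rewrite size_image card_tuple card_ord.
rewrite -sD; apply: uniq_leq_size; first exact: filter_uniq.
move=> m; rewrite mem_filter => /andP[/forallP mN _].
have Hi i : (absz (tnth m i + N%:Z)%R < N + N)%N.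
  by move: (tnth m i) (mN i) => z; lia.
apply/mapP; exists [tuple Ordinal (Hi i) | i < d.+1]; first by rewrite mem_enum.
apply: eq_from_tnth => i; rewrite !tnth_mktuple /=.
by move: (tnth m i) (mN i) => z; lia.
Qed.

Lemma sum_sqr_harmonic_le n : \sum_(0 <= k < n) a k ^+ 2 <= 2.
Proof.
(* The claim sharpened by [a n] telescopes, since [a n.+1 ^+ 2 <= a n - a n.+1]. *)
suff : \sum_(0 <= k < n.+1) a k ^+ 2 <= 2 - a n.
  move=> h; apply: le_trans (le_trans _ h) _.
    by rewrite [leRHS]big_nat_recr//= lerDl sqr_ge0.
  by rewrite gerBl harmonic_ge0.
elim: n => [|n IH].
  by rewrite big_nat1 /harmonic/= invr1 expr1n; lra.
rewrite big_nat_recr//; apply: (le_trans (lerD IH (lexx _))).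
have aB : a n - a n.+1 = a n * a n.+1.
  have n1 : n.+1%:R != 0 :> R by rewrite pnatr_eq0.
  have n2 : 1 + n.+1%:R != 0 :> R by rewrite -mulrS pnatr_eq0.
  rewrite /harmonic/= (mulrS 1 n.+1).
  by move: (n.+1%:R : R) n1 n2 => x x0 x1; field; rewrite x0 x1.
have aS : a n.+1 * a n.+1 <= a n * a n.+1.
  by rewrite ler_wpM2r ?harmonic_ge0// lef_pV2 ?posrE// ler_nat.
rewrite expr2; lra.
Qed.

Lemma sobolev_singular : sobolev (d.+1%:R / 2) f.
Proof.
split => //.
- exact: measurable_singular.
- move=> x k; congr (_ %:C); exact: Zperiodic_singular.
- split => /=; first exact: integrable_singular.
  exact: integrable0.
apply: poweR_lty.
(* A frequency is charged at every level whose cube contains it, not only at the least one; this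
   harmless overcount replaces a partition into dyadic shells. *)
pose b L m : \bar R := if [forall i, (`|tnth m i| < 2 ^ L)%N] then
  (sobolev_cst * (a L ^+ 2 * q ^+ L))%:E else 0%E.
have b0 L m : (0 <= b L m)%E.
  rewrite /b; case: ifP => // _.
  by rewrite lee_fin !mulr_ge0 ?sobolev_cst_ge0 ?sqr_ge0 ?exprn_ge0 ?invr_ge0.
apply: (@le_lt_trans _ _ (sobolev_cst * 2 ^+ d.+1 * 2)%:E); last exact: ltry.
apply: ge_ereal_sup => _ [A [finA _] <-]; rewrite fsbig_finite//.
move: (finmap.enum_fset _) (finmap.fset_uniq (fset_set A)) => s us.
apply: (@le_trans _ _ (\sum_(m <- s) \sum_(L <oo) b L m)%E).
  apply: lee_sum => m _; have [L mL mLe] := sobolev_term_le m.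
  apply: (@le_trans _ _ (b L m)).
    rewrite /b ifT ?lee_fin//; exact/forallP.
  apply: le_trans (nneseries_lim_ge L.+1 _); last by move=> *; exact: b0.
  rewrite big_mkord (bigD1 ord_max)//=.
  by rewrite leeDl// sume_ge0.
(* After the exchange, level [L] has at most [2 ^ (d.+1 * L.+1)] frequencies, and [q ^+ L] absorbs
   all but a factor [2 ^+ d.+1]. *)
rewrite -nneseries_sum; last by move=> *; exact: b0.
apply: (@le_trans _ _ (\sum_(L <oo) (sobolev_cst * 2 ^+ d.+1 * a L ^+ 2)%:E)%E).
  apply: lee_nneseries; first by move=> L _ _; exact: sume_ge0.
  move=> L _; rewrite /b -big_mkcond/= -big_filter.
  rewrite sumEFin lee_fin big_const_seq count_predT iter_addr_0.
  set n := size _.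
  have nL : (n <= (2 ^ L + 2 ^ L) ^ d.+1)%N by exact: card_cube.
  rewrite -[_ *+ n]mulr_natr.
  apply: (@le_trans _ _ (sobolev_cst * (a L ^+ 2 * q ^+ L) *
     ((2 ^ L + 2 ^ L) ^ d.+1)%:R)).
    rewrite ler_wpM2l ?ler_nat//.
    by rewrite !mulr_ge0 ?sobolev_cst_ge0 ?sqr_ge0 ?exprn_ge0 ?invr_ge0.
  rewrite addnn -mul2n natrX natrM natrX exprMn [(2 ^+ L) ^+ _]exprAC.
  have qq : q ^+ L * (2 ^+ d.+1) ^+ L = 1 by rewrite -!exprMn mulVf// !expr1n.
  rewrite le_eqVlt; apply/orP; left; apply/eqP.
  transitivity (sobolev_cst * 2 ^+ d.+1 * a L ^+ 2 *
    (q ^+ L * (2 ^+ d.+1) ^+ L)); first ring.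
  by rewrite qq mulr1.
apply: nneseries_ub => [L|n].
  by rewrite !mulr_ge0 ?sobolev_cst_ge0 ?exprn_ge0 ?harmonic_ge0.
rewrite -mulr_sumr ler_wpM2l ?sum_sqr_harmonic_le//.
by rewrite mulr_ge0 ?sobolev_cst_ge0 ?exprn_ge0//.
Qed.

End sobolev_bound.

(** * Boxes of positive measure and the essential supremum *)

Section boxes.
Context {R : realType}.

(** The point [b] is a corner rather than the centre: for [b] in [[0, 1)^d], even on the boundary, a
    small box stays inside the unit cube that carries the measure. *)
Definition box d (b : Euclidean R d) (e : R) : set (Euclidean R d) :=
  [set x | forall i, tnth b i < tnth x i < tnth b i + e].

Lemma measurable_box d (b : Euclidean R d) e : measurable (box b e).
Proof.
rewrite (_ : box b e = \bigcap_(i in [set: 'I_d])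
    ((fun x : Euclidean R d => tnth x i) @^-1` `]tnth b i, tnth b i + e[)).
  apply: fin_bigcap_measurable => // i _; rewrite -[_ @^-1` _]setTI.
  by apply: (@measurable_tnth _ (measurableTypeR R)) => //; exact: measurable_itv.
apply/seteqP; split => x /=.
  by move=> xb i _ /=; rewrite in_itv/=; exact: xb.
by move=> xb i; have := xb i I; rewrite /= in_itv.
Qed.

Lemma uniform_prob_itv (b e : R) : 0 < e -> 0 <= b -> b + e <= 1 ->
  uniform_prob (@ltr01 R) `]b, b + e[ = e%:E.
Proof.
move=> e0 b0 be; rewrite /uniform_prob (eq_integral (cst 1%E)).
  rewrite integral_cst//= mul1e lebesgue_measure_itv/= lte_fin ltrDl e0.
  by rewrite -EFinB addrAC subrr add0r.
move=> x; rewrite inE/= in_itv/= => /andP[bx xb].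
by rewrite /uniform_pdf ifT ?subr0 ?invr1//; apply/andP; split; lra.
Qed.

Lemma torus_measure_box d (b : Euclidean R d) e :
  0 < e -> (forall i, 0 <= tnth b i /\ tnth b i + e <= 1) ->
  (0 < torus_measure d (box b e))%E.
Proof.
move=> e0; elim: d => [|d IH] in b * => hb.
  rewrite (_ : box b e = setT) ?probability_setT//.
  by apply/seteqP; split => // x _ [].
pose b' : Euclidean R d := [tuple of behead b].
have b'E i : tnth b (lift ord0 i) = tnth b' i.
  by rewrite !(tnth_nth 0) /= nth_behead.
have -> : torus_measure d.+1 (box b e) =
    (uniform_prob (@ltr01 R) \x torus_measure d)%E
      (`]tnth b ord0, tnth b ord0 + e[ `*` box b' e).
  rewrite /= /distribution /pushforward /=; congr (_ _).
  apply/seteqP; split => -[t y] /=.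
    move=> tyb; split; first by have := tyb ord0; rewrite tuple_cons0 in_itv.
    by move=> i; have := tyb (lift ord0 i); rewrite tuple_consS b'E.
  rewrite in_itv => -[tb yb] i; case: (unliftP ord0 i) => [j|] ->.
    by rewrite tuple_consS b'E; exact: yb.
  by rewrite tuple_cons0.
rewrite product_measure1E//; last exact: measurable_box.
have [b0 b1] := hb ord0.
apply: mule_gt0; first by have /= -> := uniform_prob_itv e0 b0 b1; rewrite lte_fin.
by apply: IH => i; rewrite -b'E.
Qed.

(** If [M] bounded the essential supremum, the set where [g] exceeds [M] would be null, yet it
    contains a box of positive measure. *)
Lemma ess_sup_box d (g : Euclidean R d -> R) :
  (forall M, exists b e, [/\ 0 < e,
     forall i, 0 <= tnth b i /\ tnth b i + e <= 1 &
     forall x, box b e x -> M <= g x]) ->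
  ess_sup (torus_measure d) (fun x => (g x)%:E) = +oo%E.
Proof.
move=> gM; apply/eqP; rewrite -leye_eq leNgt; apply/negP => supy.
have [M supM] : exists M : R,
    (ess_sup (torus_measure d) (fun x => (g x)%:E) <= M%:E)%E.
  move: supy; case: (ess_sup _ _) => [r| |] // _; first by exists r.
  by exists 0; rewrite leNye.
have [b [e [e0 hb bM]]] := gM (M + 1).
have /ess_supP [A [mA A0 hA]] := supM.
have : (torus_measure d (box b e) <= torus_measure d A)%E.
  rewrite le_measure ?inE//; first exact: measurable_box.
  move=> x xb; apply: hA => /=; rewrite lee_fin; apply/negP.
  by rewrite -ltNge; have := bM x xb; lra.
by rewrite A0 leNgt torus_measure_box.
Qed.

(** A minimum of finitely many radii; it serves for the coordinates of a box and for the shifts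
    [n]. *)
Lemma common_radius (I : eqType) (r : seq I) (P : I -> R -> Prop) :
  (forall i e e', 0 < e' -> e' <= e -> P i e -> P i e') ->
  (forall i, i \in r -> exists2 e, 0 < e & P i e) ->
  exists2 e, 0 < e & forall i, i \in r -> P i e.
Proof.
move=> Pd; elim: r => [|j r IH] hr; first by exists 1.
have [e e0 he] := IH (fun i ir => hr i (mem_behead (s := j :: r) ir)).
have [e' e'0 he'] := hr j (mem_head _ _).
have m0 : 0 < Num.min e e' by rewrite lt_min e0.
exists (Num.min e e') => // i; rewrite inE => /orP[/eqP ->|ir].
  by apply: Pd he' => //; rewrite ge_min lexx orbT.
by apply: Pd (he i ir) => //; rewrite ge_min lexx.
Qed.

(* [b] is the representative of [- n0 alpha] modulo [Z^d] in [0, 1)^d. *)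
Lemma pole_box d (alpha : Euclidean R d) (n0 : int) :
  exists b : Euclidean R d, exists z : d.-tuple int,
    (forall i, 0 <= tnth b i < 1) /\
    forall x n i, tnth (translate x n alpha) i =
      (tnth x i - tnth b i) + tnth alpha i *~ (n - n0) + (tnth z i)%:~R.
Proof.
exists [tuple - (tnth alpha i *~ n0) -
  (Num.floor (- (tnth alpha i *~ n0)))%:~R | i < d].
exists [tuple - Num.floor (- (tnth alpha i *~ n0)) | i < d]; split=> [i|x n i].
  rewrite tnth_mktuple; set s := - _.
  have := floor_itv s; rewrite intrD => /andP[s0 s1].
  by apply/andP; split; lra.
by rewrite !tnth_mktuple mulrzBr mulrNz; ring.
Qed.

End boxes.

(** * Finite weighted sums of complex numbers *)

Section weighted_sums.
Context {R : realType}.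
Implicit Types z w : R[i].

Lemma normcD z w : Normc.normc (z + w) <= Normc.normc z + Normc.normc w.
Proof. exact: (@le_normcD R z w). Qed.

Lemma normcN z : Normc.normc (- z) = Normc.normc z.
Proof. exact: (@complex.normcN R z). Qed.

Lemma normc_ge0 z : 0 <= Normc.normc z.
Proof. by case: z => x y /=; exact: sqrtr_ge0. Qed.

Lemma normc_real (t : R) : Normc.normc t%:C = `|t|.
Proof. by rewrite /= expr0n addr0 sqrtr_sqr. Qed.

Lemma normc_sum (I : Type) (r : seq I) (P : pred I) (F : I -> R[i]) :
  Normc.normc (\sum_(i <- r | P i) F i) <= \sum_(i <- r | P i) Normc.normc (F i).
Proof.
apply: (big_ind2 (fun z (t : R) => Normc.normc z <= t)) => //.
  by rewrite Normc.normc0.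
by move=> z s w t zs wt; apply: le_trans (normcD z w) _; exact: lerD.
Qed.

Lemma Re_sum_ge0 (I : Type) (r : seq I) (P : pred I) (F : I -> R[i]) :
  (forall i, P i -> 0 <= complex.Re (F i)) ->
  0 <= complex.Re (\sum_(i <- r | P i) F i).
Proof.
move=> F0; apply: (big_ind (fun z => 0 <= complex.Re z)) => //.
by move=> [x y] [s t] /= x0 s0; exact: addr_ge0.
Qed.

Lemma weights_seq (Phi : nat -> int -> R[i]) N : weights Phi -> (0 < N)%N ->
  exists r : seq int, uniq r /\ forall h : int -> R[i],
    \sum_(n \in [set: int]) Phi N n * h n = \sum_(n <- r) Phi N n * h n.
Proof.
move=> /[apply] -[[B PhiB] _].
pose r := undup [seq k%:Z - B%:Z | k <- iota 0 (B + B).+1].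
exists r; split; first exact: undup_uniq.
move=> h; rewrite (fsbigE r) ?undup_uniq//.
  by apply: eq_bigl => n; rewrite in_setT.
move=> n _ nr; rewrite PhiB ?mul0r// ltnNge; apply: contra nr => nB.
rewrite mem_undup; apply/mapP; exists (absz (n + B%:Z)); last by lia.
by rewrite mem_iota; lia.
Qed.

(** The weights sum to 1, as the case [h = 1] shows, so they cannot all vanish. *)
Lemma weights_neq0 (Phi : nat -> int -> R[i]) N (r : seq int) :
  weights Phi -> (0 < N)%N ->
  (forall h : int -> R[i],
    \sum_(n \in [set: int]) Phi N n * h n = \sum_(n <- r) Phi N n * h n) ->
  exists2 n, n \in r & Phi N n != 0.
Proof.
move=> hPhi N0 hr; apply/hasP; apply: contraT => /hasPn Phi0.
have := hr (fun=> 1); under eq_fsbigr do rewrite mulr1.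
rewrite (proj2 (hPhi N N0)) big_seq big1 => [/eqP|n nr].
  by rewrite oner_eq0.
by move/negbNE/eqP: (Phi0 n nr) => ->; rewrite mul0r.
Qed.

End weighted_sums.

(** * Blow-up of the discrepancy *)

Section discrepancy.
Context {R : realType} (d : nat) (Phi : nat -> int -> R[i]) (N : nat).
Context (hPhi : weights Phi) (N0 : (0 < N)%N).
Context (alpha : Euclidean R d.+1).
Local Notation f := (fun x : Euclidean R d.+1 => (singular x)%:C).

(** An equality would be a rational relation with constant term [- z] and [n] as the coefficient of
    the first coordinate. *)
Lemma irrational_multiple n z : irrational_vector alpha -> n != 0 ->
  tnth alpha ord0 *~ n != z%:~R.
Proof.
move=> irr n0; apply/eqP => nz.
pose q i : rat := if i == ord0 :> 'I_d.+1 then n%:~R else 0.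
have irr0 : ratr (- z)%:~R + \sum_i ratr (q i) * tnth alpha i = 0 :> R.
  rewrite /q (bigD1 ord0)//= big1 => [|i /negPf ->]; last by rewrite rmorph0 mul0r.
  by rewrite !ratr_int addr0 mulrNz -nz mulrzl addNr.
have [_ /(_ ord0)] := irr _ _ irr0.
by rewrite /q eqxx => /eqP; rewrite intr_eq0 (negPf n0).
Qed.

(** By continuity the squared sine stays above half its value at [beta], which is positive since
    [beta] is no integer. *)
Lemma sinpi_near (beta : R) : (forall z : int, beta != z%:~R) ->
  exists2 c, 0 < c & exists2 e, 0 < e &
    forall t, 0 < t < e -> c <= sin (pi * (t + beta)) ^+ 2.
Proof.
move=> bz; have sb : 0 < sin (pi * beta) ^+ 2.
  rewrite exprn_even_gt0//=; apply: (@sinpi_neq0 _ _ (Num.floor beta)).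
  have := floor_itv beta; rewrite intrD => /andP[b0 b1].
  rewrite subr_gt0 lt_neqAle eq_sym bz b0/=; lra.
exists (sin (pi * beta) ^+ 2 / 2); first by rewrite divr_gt0.
have cs : {for 0, continuous (fun t : R => sin (pi * (t + beta)) ^+ 2)}.
  apply: (@continuous_comp _ _ _ (fun t => sin (pi * (t + beta)))
    (fun y => y ^+ 2)); last exact: exprn_continuous.
  apply: (@continuous_comp _ _ _ (fun t => pi * (t + beta)) sin);
    last exact: continuous_sin.
  apply: cvgM; first exact: cvg_cst.
  by apply: cvgD; [exact: cvg_id|exact: cvg_cst].
have : \forall t \near (0 : R),
    sin (pi * beta) ^+ 2 / 2 < sin (pi * (t + beta)) ^+ 2.
  move: cs; rewrite /prop_for /continuous_at add0r => /cvgr_gt; apply; lra.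
move=> /nbhs_ballP[e /= e0 he]; exists e => // t /andP[t0 te].
by apply/ltW/he; rewrite /ball/= sub0r normrN gtr0_norm.
Qed.

(* [translate x n0 alpha] is close to a lattice point when [x] lies in a small
   box cornered at [b], so the term [n0] only has to be compared with the rest. *)
Lemma sup_discrepancy_near_pole :
  (forall (r : seq int) n0 (b : Euclidean R d.+1) (z : d.+1.-tuple int) (M : R),
    uniq r -> n0 \in r -> Phi N n0 != 0 ->
    (forall h : int -> R[i],
      \sum_(n \in [set: int]) Phi N n * h n = \sum_(n <- r) Phi N n * h n) ->
    (forall x n i, tnth (translate x n alpha) i =
      (tnth x i - tnth b i) + tnth alpha i *~ (n - n0) + (tnth z i)%:~R) ->
    exists S e : R, 0 < e /\
      forall x, box b e x -> S <= singular (translate x n0 alpha) ->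
      M <= Normc.normc (discrepancy Phi alpha f N x)) ->
  sup_discrepancy Phi alpha f N = +oo%E.
Proof.
move=> H; apply: ess_sup_box => M.
have [r [ur hr]] := weights_seq hPhi N0.
have [n0 n0r Phi0] := weights_neq0 hPhi N0 hr.
have [b [z [b01 bz]]] := pole_box alpha n0.
have [S [e [e0 he]]] := H r n0 b z M ur n0r Phi0 hr bz.
have [e1 /andP[e10 e11] he1] := singular_unbounded d S.
have [e2 e20 he2] : exists2 e2, 0 < e2 &
    forall i, i \in enum 'I_d.+1 -> tnth b i + e2 <= 1.
  apply: common_radius => [i e3 e4 e40 e34 be|i _].
    by apply: le_trans be; rewrite lerD2l.
  by exists (1 - tnth b i); [have := b01 i; lra|rewrite addrC subrK].
(* [e] keeps the hypothesis applicable, [e1] pushes the term [n0] above [S], and [e2] keeps the box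
   in the unit cube. *)
pose e3 := Num.min e (Num.min e1 e2).
have [e3e [e31 e32]] : e3 <= e /\ (e3 <= e1 /\ e3 <= e2).
  by rewrite /e3 !ge_min !lexx !orbT.
exists b, e3; split.
- by rewrite !lt_min e0 e10 e20.
- move=> i; split; first by have /andP[] := b01 i.
  by apply: le_trans (he2 i (mem_enum _ _)); rewrite lerD2l.
move=> x xb; apply: he.
  move=> i; have /andP[-> xe] := xb i => /=.
  by apply: lt_le_trans xe _; rewrite lerD2l.
apply: (he1 _ z) => i; rewrite bz subrr mulr0z addr0 addrK.
have := xb i; lra.
Qed.

Lemma discrepancyE (r : seq int) n0 x : uniq r -> n0 \in r ->
  (forall h : int -> R[i],
    \sum_(n \in [set: int]) Phi N n * h n = \sum_(n <- r) Phi N n * h n) ->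
  discrepancy Phi alpha f N x =
    Phi N n0 * (singular (translate x n0 alpha))%:C +
    (\sum_(n <- r | n != n0) Phi N n * (singular (translate x n alpha))%:C
     - torus_integral f).
Proof. by move=> ur n0r hr; rewrite /discrepancy hr (bigD1_seq n0)//= addrA. Qed.

(** The first coordinate of every other translate stays near [tnth alpha ord0 *~ (n - n0)] modulo 1,
    which is no integer, so [singular_decay] bounds these finitely many terms on one box. *)
Lemma sup_discrepancy_irrational :
  irrational_vector alpha -> sup_discrepancy Phi alpha f N = +oo%E.
Proof.
move=> irr; apply: sup_discrepancy_near_pole => r n0 b z M ur n0r Phi0 hr bz.
have [e e0 he] : exists2 e, 0 < e & forall n, n \in r ->
    n != n0 -> exists C, forall x, box b e x ->
      singular (translate x n alpha) <= C.
  apply: common_radius => [n e e' e'0 e'e he nn0|n nr].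
    have [C hC] := he nn0; exists C => x xb; apply: hC => i.
    have /andP[-> xe] := xb i => /=.
    by apply: lt_le_trans xe _; rewrite lerD2l.
  have [->|nn0] := eqVneq n n0; first by exists 1.
  have := @sinpi_near (tnth alpha ord0 *~ (n - n0)).
  case=> [z'|c c0 [e e0 he]].
    by apply: irrational_multiple => //; rewrite subr_eq0.
  exists e => // _; exists (2 / c) => x xb.
  have sc : c <= sin (pi * tnth (translate x n alpha) ord0) ^+ 2.
    rewrite bz sqr_sinpiDz; apply: he; have := xb ord0; lra.
  have s0 := lt_le_trans c0 sc.
  apply: le_trans (singular_decay (i := ord0) _) _.
    by move: s0; rewrite exprn_even_gt0.
  by rewrite ler_pM2l// lef_pV2.
have [C hC] : exists C : R, forall x, box b e x ->
    Normc.normc (\sum_(n <- r | n != n0)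
      Phi N n * (singular (translate x n alpha))%:C - torus_integral f) <= C.
  (* The bound is made total in [n], with 0 as default, so that [choice] applies. *)
  have {}he n : exists C, n \in r -> n != n0 -> forall x, box b e x ->
      singular (translate x n alpha) <= C.
    have [nr|nr] := boolP (n \in r); last by exists 0.
    have [->|nn0] := eqVneq n n0; first by exists 0.
    by have [C hC] := he n nr nn0; exists C.
  have [C hC] := choice he.
  exists (\sum_(n <- r | n != n0) Normc.normc (Phi N n) * C n
    + Normc.normc (torus_integral f)) => x xb.
  apply: le_trans (normcD _ _) _; rewrite normcN lerD2r.
  apply: le_trans (normc_sum _ _ _) _.
  rewrite big_seq_cond [leRHS]big_seq_cond; apply: ler_sum => n /andP[nr nn0].
  rewrite Normc.normcM normc_real ger0_norm ?singular_ge0//.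
  by rewrite ler_wpM2l ?normc_ge0// hC.
have P0 : 0 < Normc.normc (Phi N n0).
  rewrite lt_def normc_ge0 andbT; apply: contra Phi0 => /eqP.
  by move=> /Normc.eq0_normc ->.
(* The threshold at which the reverse triangle inequality leaves [M] after losing [C]. *)
exists ((M + C) / Normc.normc (Phi N n0)), e; split=> // x xb.
rewrite ler_pdivrMr// => MC; have := hC x xb.
rewrite (discrepancyE _ ur n0r hr); set A := Phi N n0 * _; set B := _ - _.
move=> BC; have := normcD (A + B) (- B); rewrite addrK normcN.
rewrite {1}/A Normc.normcM normc_real ger0_norm ?singular_ge0// mulrC => AB.
lra.
Qed.

(** The other terms have nonnegative real parts wherever the translates land, so dropping them can
    only lower the real part of the sum. *)
Lemma sup_discrepancy_nonneg :
  (forall n, 0 <= Phi N n) -> sup_discrepancy Phi alpha f N = +oo%E.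
Proof.
move=> Phi_ge0; apply: sup_discrepancy_near_pole => r n0 b z M ur n0r Phi0 hr bz.
have RePhi n : 0 <= complex.Re (Phi N n).
  by have := Phi_ge0 n; rewrite lecE => /andP[].
have P0 : 0 < complex.Re (Phi N n0).
  (* Nonnegativity in [R[i]] includes a zero imaginary part, so a zero real part would make the
     weight vanish. *)
  rewrite lt_def RePhi andbT; apply: contra Phi0 => Re0.
  by have := Phi_ge0 n0; rewrite lecE eq_complex Re0 => /andP[-> _].
have ReM z' (t : R) : complex.Re (z' * t%:C) = complex.Re z' * t.
  by case: z' => u v /=; rewrite mulr0 subr0.
(* The radius 1 is arbitrary: [sup_discrepancy_near_pole] shrinks the box itself. *)
exists ((M + complex.Re (torus_integral f)) / complex.Re (Phi N n0)), 1.
split=> // x _; rewrite ler_pdivrMr// => MS.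
apply: le_trans (Re_le_normc _); rewrite (discrepancyE _ ur n0r hr).
set A := Phi N n0 * _; set B := \sum_(n <- r | _) _.
have B0 : 0 <= complex.Re B.
  by apply: Re_sum_ge0 => n _; rewrite ReM mulr_ge0 ?singular_ge0.
have -> : complex.Re (A + (B - torus_integral f)) =
    complex.Re A + complex.Re B - complex.Re (torus_integral f).
  case: A => ? ?; case: B B0 => ? ? _; case: (torus_integral f) => ? ? /=.
  by rewrite addrA.
rewrite /A ReM mulrC; lra.
Qed.

End discrepancy.

Theorem theorem1p4 (R : realType) (d : nat) (hd : (1 <= d)%N)
    (Phi : nat -> int -> R[i]) (hPhi : weights Phi) :
  exists f : Euclidean R d -> R[i],
    [/\ sobolev (d%:R / 2) f,
        forall alpha : Euclidean R d, irrational_vector alpha ->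
          forall N : nat, (0 < N)%N ->
            sup_discrepancy Phi alpha f N = +oo%E
      & forall N : nat, (0 < N)%N -> (forall n : int, 0 <= Phi N n) ->
          forall alpha : Euclidean R d,
            sup_discrepancy Phi alpha f N = +oo%E].
Proof.
(* The witness depends on the dimension alone, which [hd] allows to be written as a successor. *)
case: d hd => // d _; exists (fun x => (singular x)%:C); split.
- exact: sobolev_singular.
- by move=> alpha irr N N0; exact: sup_discrepancy_irrational.
- by move=> N N0 Phi0 alpha; exact: sup_discrepancy_nonneg.
Qed.
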